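(* Let $S$ be a regular $*$-semigroup with projection algebra $P=\mathbf P(S)$. Then the map $\mathbf E(P)\to\mathbf E(S)$, $[\![p,q]\!]\mapsto pq$ (for $p,q\in P$ with $p\mathrel{\mathscr F}q$), is an isomorphism of $*$-bosets.
   Context: Maps are written to the right of their arguments and composed left to right. A regular $*$-semigroup is a semigroup $S$ with a unary operation $a\mapsto a^*$ satisfying $(a^* )^*=a=aa^*a$ and $(ab)^*=b^*a^*$. Put $\mathbf P(S)=\{p\in S:p^2=p=p^*\}$ (projections) and $\mathbf E(S)=\{e\in S:e^2=e\}$ (idempotents). A projection algebra is a set $P$ with unary operations $\theta_p:P\to P$ ($p\in P$) such that for all $p,q\in P$: $p\theta_p=p$; $\theta_p\theta_p=\theta_p$; $p\theta_q\theta_p=q\theta_p$; $\theta_p\theta_q\theta_p=\theta_{q\theta_p}$; $\theta_p\theta_q\theta_p\theta_q=\theta_p\theta_q$. For a regular $*$-semigroup $S$, $\mathbf P(S)$ is a projection algebra with $q\theta_p=pqp$. On $P$ define $p\leq_{\mathscr F}q$ iff $p=q\theta_p$; $p\mathrel{\mathscr F}q$ iff $p\leq_{\mathscr F}q$ and $q\leq_{\mathscr F}p$. A $P$-path is a tuple $(p_1,\ldots,p_k)$ ($k\geq1$) with $p_1\mathrel{\mathscr F}\cdots\mathrel{\mathscr F}p_k$, regarded as a morphism $p_1\to p_k$; the path category $\mathscr P(P)$ consists of all $P$-paths under $(p_1,\ldots,p_k)\circ(p_k,\ldots,p_l)=(p_1,\ldots,p_k,\ldots,p_l)$. A pair $(e,f)\in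 P\times P$ is $p$-linked ($p\in P$) if $f=e\theta_p\theta_f$ and $e=f\theta_p\theta_e$. Let $\equiv$ be the (category) congruence on $\mathscr P(P)$ generated by all pairs $((p,p),(p))$ with $p\in P$, all $((p,q,p),(p))$ with $p\mathrel{\mathscr F}q$, and all $((e,e\theta_p,f),(e,f\theta_p,f))$ with $p\in P$ and $(e,f)$ $p$-linked. The $\equiv$-class of $(p_1,\ldots,p_k)$ is $[\![p_1,\ldots,p_k]\!]$. The regular $*$-semigroup $\mathsf{PG}(P)$ consists of all these classes, with $[\![p_1,\ldots,p_k]\!]^*=[\![p_k,\ldots,p_1]\!]$ and $[\![p_1,\ldots,p_k]\!]\bullet[\![q_1,\ldots,q_l]\!]=[\![p_1',\ldots,p_k',q_1',\ldots,q_l']\!]$, where, with $p'=q_1\theta_{p_k}$ and $q'=p_k\theta_{q_1}$, $p_i'=p'\theta_{p_k}\cdots\theta_{p_i}$ and $q_j'=q'\theta_{q_1}\cdots\theta_{q_j}$. Put $\mathbf E(P)=\mathbf E(\mathsf{PG}(P))=\{[\![p,q]\!]:p\mathrel{\mathscr F}q\}$. For a semigroup $T$ with $E=\mathbf E(T)$, let $\mathrm{BP}(E)=\{(e,f)\in E\times E:\{e,f\}\cap\{ef,fe\}\neq\varnothing\}$ (basic pairs); then $ef\in E$ for $(e,f)\in\mathrm{BP}(E)$, and $E$ with the partial operation $(e,f)\mapsto ef$ defined exactly on $\mathrm{BP}(E)$ is the boset (biordered set) of $T$. If $T$ is a regular $*$-semigroup, $E$ together with the restriction of $^*$ is a regular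 $*$-boset. An isomorphism of $*$-bosets is a bijection $\phi:E\to E'$ such that $(e,f)\in\mathrm{BP}(E)\Leftrightarrow(e\phi,f\phi)\in\mathrm{BP}(E')$, $(ef)\phi=(e\phi)(f\phi)$ for all $(e,f)\in\mathrm{BP}(E)$, and $(e^* )\phi=(e\phi)^*$ for all $e\in E$. *)

(* Defs.v *)
From HB Require Import structures.
From mathcomp Require Import all_boot.
From mathcomp Require Import boolp.
From Stdlib Require Import Relation_Operators.

Set Implicit Arguments.
Unset Strict Implicit.
Unset Printing Implicit Defensive.

Local Open Scope group_scope.
Local Open Scope quotient_scope.

HB.mixin Record Semigroup_isRegStar S of Semigroup S := {
  star : S -> S;
  starK : involutive star;
  mul_star_mul : forall a : S, a * star a * a = a;
  starM : forall a b : S, star (a * b) = star b * star a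
}.

#[short(type="regStarSemigroupType")]
HB.structure Definition RegStarSemigroup :=
  {S of Semigroup_isRegStar S & Semigroup S}.

(* [theta p x] is x \theta_p: maps are written on the right of their arguments,
   and [x \theta_p \theta_q] applies [theta p] first. *)
HB.mixin Record isProjAlgebra P of Choice P := {
  theta : P -> P -> P;
  theta_self : forall p, theta p p = p;
  theta_idem : forall p x, theta p (theta p x) = theta p x;
  theta_sym : forall p q, theta p (theta q p) = theta p q;
  theta_conj : forall p q x,
    theta p (theta q (theta p x)) = theta (theta p q) x;
  theta_alt : forall p q x,
    theta q (theta p (theta q (theta p x))) = theta q (theta p x)
}.

#[short(type="projAlgebraType")]
HB.structure Definition ProjAlgebra := {P of isProjAlgebra P & Choice P}.

Notation "x '\theta_' p" := (theta p x)
  (at level 40, p at level 2, left associativity, format "x  \theta_ p").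

Section Friendliness.
Variable P : projAlgebraType.
Implicit Types p q : P.

Definition leF p q : bool := p == q \theta_p.

Definition friendly p q : bool := leF p q && leF q p.

Definition linked p e f : Prop :=
  f = e \theta_p \theta_f /\ e = f \theta_p \theta_e.

Lemma friendly_refl p : friendly p p.
Proof. by rewrite /friendly /leF theta_self eqxx. Qed.

Lemma friendly_sym p q : friendly p q = friendly q p.
Proof. exact: andbC. Qed.

Lemma friendlyP p q :
  reflect (q \theta_p = p /\ p \theta_q = q) (friendly p q).
Proof.
rewrite /friendly /leF (eq_sym p) (eq_sym q).
by apply: (iffP andP) => -[/eqP -> /eqP ->].
Qed.

Lemma theta2_alt x p q :
  x \theta_p \theta_q \theta_p \theta_q = x \theta_p \theta_q.
Proof. exact: theta_alt. Qed.

Lemma friendly_cross p q : friendly (p \theta_q) (q \theta_p).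
Proof.
apply/friendlyP; split; rewrite -theta_conj.
  by rewrite theta2_alt theta_sym.
by rewrite theta2_alt theta_sym.
Qed.

(* [act y p] is [y \theta_p] with its arguments in the order that [scanl] and
   [foldl] expect. *)
Definition act y p : P := y \theta_p.

Lemma friendly_step p q y : y \theta_p = y -> friendly p q ->
  friendly y (y \theta_q).
Proof.
move=> yp /friendlyP[qp _].
suff qy : q \theta_y = y by have := friendly_cross q y; rewrite qy.
by rewrite -[in LHS]yp -theta_conj qp theta_sym yp.
Qed.

End Friendliness.

Arguments friendly {P} p q.
Arguments act {P} y p.

(* The path (p_1, ..., p_k) is encoded by the pair of its first entry and of
   the list of the remaining entries, so that it is never empty. *)
Record ppath (P : projAlgebraType) := PPath {
  ppath_val : P * seq P;
  _ : path friendly ppath_val.1 ppath_val.2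
}.

HB.instance Definition _ (P : projAlgebraType) :=
  [isSub of ppath P for @ppath_val P].
HB.instance Definition _ (P : projAlgebraType) := [Choice of ppath P by <:].

Section PathCategory.
Variable P : projAlgebraType.
Implicit Types (p q e f x y : P) (s t u v : seq P) (a b c : ppath P).

Definition psrc a : P := (ppath_val a).1.
Definition ptail a : seq P := (ppath_val a).2.
Definition ptgt a : P := last (psrc a) (ptail a).
Definition pseq a : seq P := psrc a :: ptail a.

Lemma ppathP a : path friendly (psrc a) (ptail a).
Proof. by case: a. Qed.

Definition mkpath p s (h : path friendly p s) : ppath P :=
  PPath (h : path friendly (p, s).1 (p, s).2).

Lemma pseq_inj : injective pseq.
Proof. by move=> [[p s] h] [[q t] k] [] pq st; apply: val_inj; congr pair. Qed.

Definition pid p : ppath P := @mkpath p [::] isT.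

Lemma ppair_subproof p q : friendly p q -> path friendly p [:: q].
Proof. by move=> /= ->. Qed.

Definition ppair p q (h : friendly p q) : ppath P := mkpath (ppair_subproof h).

Lemma pcomp_subproof a b : ptgt a = psrc b ->
  path friendly (psrc a) (ptail a ++ ptail b).
Proof. by move=> h; rewrite cat_path ppathP -/(ptgt a) h ppathP. Qed.

Definition pcomp a b (h : ptgt a = psrc b) : ppath P :=
  mkpath (pcomp_subproof h).

Lemma prev_subproof a :
  path friendly (ptgt a) (rev (belast (psrc a) (ptail a))).
Proof.
rewrite rev_path (eq_path (e' := friendly)) ?ppathP // => p q.
exact: friendly_sym.
Qed.

Definition prevp a : ppath P := mkpath (prev_subproof a).

(* The pairs generating the congruence, as sequences of projections; both sides
   are always paths, see [pgen_path]. *)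
Inductive pgen : seq P -> seq P -> Prop :=
| PgenId p : pgen [:: p; p] [:: p]
| PgenBack p q of friendly p q : pgen [:: p; q; p] [:: p]
| PgenLink p e f of linked p e f :
    pgen [:: e; e \theta_p; f] [:: e; f \theta_p; f].

Inductive pequiv : ppath P -> ppath P -> Prop :=
| PequivGen a b of pgen (pseq a) (pseq b) : pequiv a b
| PequivRefl a : pequiv a a
| PequivSym a b of pequiv a b : pequiv b a
| PequivTrans a b c of pequiv a b & pequiv b c : pequiv a c
| PequivComp a a' b b' (h : ptgt a = psrc b) (h' : ptgt a' = psrc b')
    of pequiv a a' & pequiv b b' : pequiv (pcomp h) (pcomp h').

Definition pequivb a b : bool := `[< pequiv a b >].

Lemma pequivb_refl : reflexive pequivb.
Proof. by move=> a; apply/asboolP; exact: PequivRefl. Qed.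

Lemma pequivb_sym : symmetric pequivb.
Proof. by move=> a b; apply/asboolP/asboolP; exact: PequivSym. Qed.

Lemma pequivb_trans : transitive pequivb.
Proof.
by move=> b a c /asboolP ab /asboolP bc; apply/asboolP; exact: PequivTrans bc.
Qed.

Canonical pequiv_equiv : equiv_rel (ppath P) :=
  EquivRel pequivb pequivb_refl pequivb_sym pequivb_trans.

Definition PG : Type := {eq_quot pequiv_equiv}.

HB.instance Definition _ := Choice.on PG.
HB.instance Definition _ := EqQuotient.on PG.

Definition pclass a : PG := \pi_PG a.

Lemma pclassP a b : pclass a = pclass b <-> pequiv a b.
Proof.
split=> [/eqP|ab]; first by rewrite /pclass eqmodE => /asboolP.
by apply/eqP; rewrite /pclass eqmodE; apply/asboolP.
Qed.

(* [prestr x a] is the path (x_1, ..., x_k), where a = (p_1, ..., p_k) and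
   x_i = x \theta_(p_1) ... \theta_(p_i). *)
Lemma prestr_subproof x a :
  path friendly (x \theta_(psrc a)) (scanl act (x \theta_(psrc a)) (ptail a)).
Proof.
move: (psrc a) (ptail a) (ppathP a) => p s; elim: s p x => //= q s IHs p x.
by case/andP=> pq qs; rewrite (friendly_step _ pq) ?theta_idem //= IHs.
Qed.

Definition prestr x a : ppath P := mkpath (prestr_subproof x a).

Lemma pseq_prestr x a : pseq (prestr x a) = scanl act x (pseq a).
Proof. by []. Qed.

Lemma pseq_prev a : pseq (prevp a) = rev (pseq a).
Proof. by rewrite {2}/pseq lastI rev_rcons. Qed.

Lemma pjuxt_subproof a b : friendly (ptgt a) (psrc b) ->
  path friendly (psrc a) (ptail a ++ pseq b).
Proof. by move=> h; rewrite cat_path ppathP /= h ppathP. Qed.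

Definition pjuxt a b (h : friendly (ptgt a) (psrc b)) : ppath P :=
  mkpath (pjuxt_subproof h).

Lemma psrc_prev a : psrc (prevp a) = ptgt a.
Proof. by []. Qed.

Lemma ptgt_prev a : ptgt (prevp a) = psrc a.
Proof.
case: a => -[p s] h; rewrite /ptgt /psrc /ptail /= /ptgt /psrc /ptail /= {h}.
by case: s => //= q s; rewrite rev_cons last_rcons.
Qed.

Lemma pmul_subproof a b :
  friendly (ptgt (prevp (prestr (psrc b \theta_(ptgt a)) (prevp a))))
           (psrc (prestr (ptgt a \theta_(psrc b)) b)).
Proof. by rewrite ptgt_prev /= /psrc /= !theta_idem friendly_cross. Qed.

(* With p' = q_1 \theta_(p_k) and q' = p_k \theta_(q_1), this is
   (p_1', ..., p_k', q_1', ..., q_l'), see [pseq_pmul]. *)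
Definition pmul a b : ppath P := pjuxt (pmul_subproof a b).

Lemma pseq_pmul a b :
  pseq (pmul a b) =
    rev (scanl act (psrc b \theta_(ptgt a)) (rev (pseq a))) ++
    scanl act (ptgt a \theta_(psrc b)) (pseq b).
Proof. by rewrite -pseq_prev -pseq_prestr -pseq_prev. Qed.

Definition rstep s t : Prop :=
  exists u v A B, [/\ pgen A B, s = u ++ A ++ v & t = u ++ B ++ v].

Definition req : seq P -> seq P -> Prop := clos_refl_sym_trans (seq P) rstep.

Lemma req_refl s : req s s. Proof. exact: rst_refl. Qed.
Lemma req_sym s t : req s t -> req t s. Proof. exact: rst_sym. Qed.
Lemma req_trans s t u : req s t -> req t u -> req s u.
Proof. exact: rst_trans. Qed.

Lemma req_ind (R : seq P -> seq P -> Prop) :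
    (forall s, R s s) -> (forall s t, R s t -> R t s) ->
    (forall s t u, req s t -> R s t -> R t u -> R s u) ->
    (forall u v A B, pgen A B -> R (u ++ A ++ v) (u ++ B ++ v)) ->
  forall s t, req s t -> R s t.
Proof.
move=> Rr Rs Rt Rg s t; elim=> {s t} [s t [u [v [A [B [g -> ->]]]]]|s|s t _|s t u rst st _].
- exact: Rg.
- exact: Rr.
- exact: Rs.
- exact: Rt rst st.
Qed.

Lemma req_gen A B : pgen A B -> req A B.
Proof. by move=> g; apply: rst_step; exists [::], [::], A, B; rewrite !cats0. Qed.

Lemma req_ctx u v s t : req s t -> req (u ++ s ++ v) (u ++ t ++ v).
Proof.
elim/req_ind=> {s t} [s|s t|s t w|w z A B g].
- exact: req_refl.
- exact: req_sym.
- by move=> _; exact: req_trans.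
- by apply: rst_step; exists (u ++ w), (z ++ v), A, B; rewrite -!catA.
Qed.

Lemma req_cat s s' t t' : req s s' -> req t t' -> req (s ++ t) (s' ++ t').
Proof.
move=> ss' tt'; apply: (@req_trans _ (s' ++ t)); first exact: (@req_ctx [::]).
by have := req_ctx s' [::] tt'; rewrite !cats0.
Qed.

Lemma linked_sym p e f : linked p e f -> linked p f e.
Proof. by case. Qed.

Lemma req_rev s t : req s t -> req (rev s) (rev t).
Proof.
elim/req_ind=> {s t} [s|s t|s t w|w z A B g].
- exact: req_refl.
- exact: req_sym.
- by move=> _; exact: req_trans.
rewrite !rev_cat -!catA; apply: req_ctx; case: g => [p|p q pq|p e f l].
- exact/req_gen/PgenId.
- exact/req_gen/PgenBack.
- exact/req_sym/req_gen/PgenLink/linked_sym.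
Qed.

Definition ispath s := if s is p :: s' then path friendly p s' else false.

Lemma linked_friendly p e f :
  linked p e f -> friendly e (e \theta_p) /\ friendly (e \theta_p) f.
Proof.
move=> [fE eE].
have ee : e \theta_p \theta_e = e by have := theta2_alt f p e; rewrite -eE.
split; apply/friendlyP; split=> //; rewrite -theta_conj ?ee //.
by rewrite -eE.
Qed.

Lemma pgenE A B : pgen A B -> exists p s t,
  [/\ A = p :: s, B = p :: t, last p s = last p t,
      path friendly p s & path friendly p t].
Proof.
case=> [p|p q pq|p e f l].
- by exists p, [:: p], [::]; split; rewrite //= friendly_refl.
- by exists p, [:: q; p], [::]; split; rewrite //= pq friendly_sym pq.
have [l1 l2] := linked_friendly l.
have [m1 m2] := linked_friendly (linked_sym l).
exists e, [:: e \theta_p; f], [:: f \theta_p; f].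
split; rewrite //= ?l1 ?l2 // (friendly_sym e) m2 (friendly_sym _ f) m1.
by [].
Qed.

Lemma pgen_path A B : pgen A B -> ispath A /\ ispath B.
Proof. by case/pgenE=> p [s [t [-> ->]]]. Qed.

Lemma req_invar s t : req s t ->
  (forall x, head x s = head x t) /\ (forall x, last x s = last x t) /\
  ispath s = ispath t.
Proof.
elim/req_ind=> {s t} [s|s t|s t w|u v A B].
- by [].
- by move=> [h1 [h2 h3]]; split; [|split].
- by move=> _ [h1 [h2 ->]] [k1 [k2 ->]]; split; [|split] => // x;
    rewrite ?h1 ?h2.
case/pgenE=> p [s [t [-> -> st ps pt]]]; split; [|split].
- by case: u.
- by move=> x; rewrite !last_cat /= st.
- by case: u => [|x u] /=; rewrite ?(cat_path _ _ u) /= !cat_path ps pt st.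
Qed.

Lemma mkpathP s : ispath s -> exists a, pseq a = s.
Proof. by case: s => // p s h; exists (mkpath h). Qed.

Lemma ispath_pseq a : ispath (pseq a). Proof. exact: ppathP. Qed.

Lemma pseq_pcomp a b (h : ptgt a = psrc b) :
  pseq (pcomp h) = pseq a ++ ptail b.
Proof. by []. Qed.

Lemma req_pequiv a b : req (pseq a) (pseq b) -> pequiv a b.
Proof.
have [s def_s] : exists s, pseq a = s by exists (pseq a).
have [t def_t] : exists t, pseq b = t by exists (pseq b).
rewrite def_s def_t => st.
elim/req_ind: {s t} st a b def_s def_t => [s|s t IH|s t w st IH1 IH2|u v A B g] a b.
- by move=> <- /pseq_inj ->; exact: PequivRefl.
- by move=> da db; apply/PequivSym/IH.
- move=> da db; have [_ [_]] := req_invar st.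
  rewrite -{1}da ispath_pseq => /esym/mkpathP[c dc].
  exact: PequivTrans (IH1 _ _ da dc) (IH2 _ _ dc db).
have [p [s [t [dA dB lst ps pt]]]] := pgenE g; rewrite {}dA {}dB in g *.
move=> da db.
have pv : path friendly (last p s) v.
  have := ispath_pseq a; rewrite da.
  by case: (u) => [|x u'] /=; rewrite ?(cat_path _ _ u') /= cat_path;
    [case/andP | case/and4P].
have pu : ispath (rcons u p).
  have := ispath_pseq a; rewrite da.
  case: (u) => [|x u'] //=; rewrite cat_path /= rcons_path.
  by case/and3P => -> ->.
have [a1 d1] := mkpathP pu.
have t1 : ptgt a1 = p.
  by rewrite /ptgt -(last_cons p) -/(pseq a1) d1 last_rcons.
pose a2 := mkpath ps; pose b2 := mkpath pt; pose a3 := mkpath pv.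
have h3 : ptgt (pcomp (t1 : ptgt a1 = psrc a2)) = psrc a3.
  by rewrite /ptgt /= -[RHS]/(last p s) /pcomp /= last_cat -/(ptgt a1) t1.
have k3 : ptgt (pcomp (t1 : ptgt a1 = psrc b2)) = psrc a3.
  by rewrite /ptgt /= -[RHS]/(last p s) lst /pcomp /= last_cat -/(ptgt a1) t1.
have -> : a = pcomp h3.
  by apply: pseq_inj; rewrite !pseq_pcomp d1 da /= -cats1 -!catA.
have -> : b = pcomp k3.
  by apply: pseq_inj; rewrite !pseq_pcomp d1 db /= -cats1 -!catA.
apply: PequivComp; last exact: PequivRefl.
by apply: PequivComp; [exact: PequivRefl | exact: PequivGen].
Qed.

Lemma pequiv_req a b : pequiv a b -> req (pseq a) (pseq b).
Proof.
elim=> {a b} [a b|a|a b _|a b c _ ab _|a a' b b' h h' _ aa' _ bb'].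
- exact: req_gen.
- exact: req_refl.
- exact: req_sym.
- exact: req_trans.
rewrite !pseq_pcomp.
apply: (@req_trans _ (pseq a ++ ptail b')); last exact: req_cat (req_refl _).
have sb : psrc b = psrc b' by have [/(_ (psrc b))] := req_invar bb'.
have E c d : ptgt c = psrc d ->
    pseq c ++ ptail d = belast (psrc c) (ptail c) ++ pseq d.
  by move=> e; rewrite {1}/pseq lastI cat_rcons -/(ptgt c) e.
by rewrite !E -?sb //; exact: req_cat (req_refl _) _.
Qed.

Lemma scanl_cat x s t :
  scanl act x (s ++ t) = scanl act x s ++ scanl act (foldl act x s) t.
Proof. by elim: s x => //= p s IHs x; rewrite IHs. Qed.

Lemma theta_le x e r : r = x \theta_e -> r \theta_e = r.
Proof. by move=> ->; rewrite theta_idem. Qed.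

Lemma pgen_scanl A B x : pgen A B ->
  foldl act x A = foldl act x B /\ req (scanl act x A) (scanl act x B).
Proof.
case=> [p|p q /friendlyP[qp pq]|p e f [fE eE]]; rewrite /= /act.
- by rewrite !theta_idem; split=> //; exact/req_gen/PgenId.
- move: (x \theta_p) (theta_idem p x) => r rp.
  have rqp : r \theta_q \theta_p = r by rewrite -{1}rp theta_conj qp.
  by split=> //; rewrite rqp; apply/req_gen/PgenBack/(friendly_step rp)/friendlyP.
move: (x \theta_e) (theta_idem e x) => r re.
have e1 : r \theta_(e \theta_p) = r \theta_p.
  by rewrite -theta_conj -{1}re theta2_alt re.
have f1 : r \theta_(f \theta_p) = r \theta_p \theta_f \theta_p.
  by rewrite theta_conj.
have f2 : r \theta_p \theta_f \theta_p \theta_f = r \theta_p \theta_f.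
  exact: theta2_alt.
rewrite e1 f1 f2; split=> //.
have fr : r \theta_p \theta_f \theta_p \theta_r = r.
  rewrite theta_conj theta_sym -{1}re -theta_conj -eE.
  by rewrite theta_sym re.
apply/req_gen/PgenLink; split; rewrite ?fr //.
by rewrite -!theta_conj fr.
Qed.

Lemma req_scanl s t x : req s t -> foldl act x s = foldl act x t /\
  req (scanl act x s) (scanl act x t).
Proof.
move=> st; elim/req_ind: {s t} st x => [s|s t IH|s t w _ IH1 IH2|u v A B g] x.
- by split=> //; exact: req_refl.
- by have [-> ?] := IH x; split=> //; exact: req_sym.
- have [-> r1] := IH1 x; have [-> r2] := IH2 x; split=> //.
  exact: req_trans r1 r2.
rewrite !foldl_cat !scanl_cat.
have [-> r] := pgen_scanl (foldl act x u) g; split=> //; exact: req_ctx.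
Qed.

(* [rscan] transports a projection from right to left along a path. *)
Definition rscan x s := rev (scanl act x (rev s)).

Lemma req_rscan s t x : req s t -> req (rscan x s) (rscan x t).
Proof. by move=> /req_rev/(@req_scanl _ _ x)[_] /req_rev. Qed.

Lemma scanl_pmul a b : pseq (pmul a b) =
  rscan (psrc b) (pseq a) ++ scanl act (ptgt a) (pseq b).
Proof.
rewrite pseq_pmul /rscan; congr (rev _ ++ _); last by rewrite /= /act theta_idem.
by rewrite /pseq lastI rev_rcons /= /act -/(ptgt a) theta_idem.
Qed.

Lemma pequiv_pmul a a' b b' :
  pequiv a a' -> pequiv b b' -> pequiv (pmul a b) (pmul a' b').
Proof.
move=> /pequiv_req aa' /pequiv_req bb'; apply: req_pequiv.
have [_ [/(_ (psrc a)) /= aE _]] := req_invar aa'.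
have [/(_ (psrc b)) /= bE _] := req_invar bb'.
rewrite !scanl_pmul /ptgt aE bE; apply: req_cat; first exact: req_rscan.
by case: (req_scanl (last (psrc a') (ptail a')) bb').
Qed.

Lemma pequiv_prev a b : pequiv a b -> pequiv (prevp a) (prevp b).
Proof.
by move=> /pequiv_req/req_rev ab; apply: req_pequiv; rewrite !pseq_prev.
Qed.

Lemma rscan_cons y p s :
  rscan y (p :: s) = foldl act y (rev s) \theta_p :: rscan y s.
Proof. by rewrite /rscan rev_cons -cats1 scanl_cat cats1 rev_rcons. Qed.

Lemma foldl_rcons_rev y p s :
  foldl act y (rev (p :: s)) = foldl act y (rev s) \theta_p.
Proof. by rewrite rev_cons -cats1 foldl_cat. Qed.

Lemma scanl_scanl x y p s : path friendly p s ->
  scanl act y (scanl act x (p :: s)) = scanl act (y \theta_p \theta_x) (p :: s).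
Proof.
elim: s p x y => [|q s IHs] p x y /=.
  by rewrite /act -theta_conj.
case/andP => /friendlyP[qp pq] qs; rewrite /act -theta_conj; congr cons.
set z := y \theta_p \theta_x \theta_p.
rewrite -[LHS]/(scanl act z (scanl act (x \theta_p) (q :: s))) IHs //.
have zp : z \theta_p = z by rewrite theta_idem.
rewrite -[RHS]/(scanl act z (q :: s)); congr scanl.
rewrite -theta_conj -{1}zp (theta_conj p q) qp zp.
by rewrite /z theta2_alt.
Qed.

Lemma rscan_rscan x y p s : path friendly p s ->
  rscan y (rscan x (p :: s)) = rscan (y \theta_(last p s) \theta_x) (p :: s).
Proof.
move=> ps; rewrite /rscan revK.
rewrite lastI rev_rcons scanl_scanl // rev_path.
by rewrite (eq_path (e' := friendly)) // => q r; rewrite friendly_sym.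
Qed.

Lemma rscan_scanl x y s : ispath s ->
  rscan y (scanl act x s) = scanl act (foldl act y (rev s) \theta_x) s /\
  foldl act y (rev (scanl act x s)) = foldl act y (rev s) \theta_x \theta_(head x s).
Proof.
case: s => // p s; elim: s p x => [|q s IHs] p x.
  by move=> _; rewrite /rscan /= /act -theta_conj.
case/andP => /friendlyP[qp pq] /(IHs q (x \theta_p))[IH1 IH2].
have -> : scanl act x (p :: q :: s) =
    x \theta_p :: scanl act (x \theta_p) (q :: s) by [].
rewrite rscan_cons !(foldl_rcons_rev y (x \theta_p)).
rewrite IH1 IH2 (foldl_rcons_rev y p) [head x _]/= [head _ (q :: s)]/=.
set g := foldl act y (rev (q :: s)); set h := x \theta_p.
have hp : h \theta_p = h by rewrite theta_idem.
have qh : q \theta_h = h.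
  by rewrite -theta_conj qp theta_sym.
have gh : g \theta_h \theta_q \theta_h = g \theta_h.
  by rewrite -{1}(theta_idem h) theta_conj qh theta_idem.
have E : g \theta_h = act (act g p \theta_x) p by rewrite /act theta_conj.
rewrite /= gh; split; last by rewrite E.
by congr cons; rewrite // -?E //.
Qed.

Lemma scanl_rscan x y s : ispath s ->
  scanl act x (rscan y s) = rscan (foldl act x s \theta_y) s.
Proof.
move=> ps; have rs : ispath (rev s).
  have [a <-] := mkpathP ps; rewrite -pseq_prev; exact: ispath_pseq.
have [E _] := rscan_scanl y x rs.
by move: E; rewrite revK /rscan => <-; rewrite revK.
Qed.

Lemma scanl_theta x p s : scanl act (x \theta_p) (p :: s) = scanl act x (p :: s).
Proof. by rewrite /= /act theta_idem. Qed.

Lemma rscan_theta x p s :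
  rscan (x \theta_(last p s)) (p :: s) = rscan x (p :: s).
Proof. by rewrite /rscan lastI rev_rcons scanl_theta. Qed.

Lemma theta_foldl x y s :
  x \theta_(foldl act y s) = foldl act (foldl act x (rev s) \theta_y) s.
Proof.
elim: s x y => //= p s IHs x y; rewrite IHs foldl_rcons_rev.
by rewrite /act -theta_conj.
Qed.

(* The two ways around a path, for a pair linked by that path. *)
Lemma req_linked_path e f p s :
    f = foldl act e (p :: s) \theta_f ->
    e = foldl act f (rev (p :: s)) \theta_e ->
  req (e :: scanl act e (p :: s) ++ [:: f]) (e :: rscan f (p :: s) ++ [:: f]).
Proof.
elim: s p e => [|q s IHs] p e fE eE; first exact/req_gen/PgenLink.
apply: (@req_trans _ (e :: act e p :: rscan f (q :: s) ++ [:: f])).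
  apply: (req_cat (req_refl [:: e])); apply: IHs => //.
  move: eE; rewrite foldl_rcons_rev; move: (foldl _ _ _) => g eE.
  by rewrite /act -theta_conj -eE.
rewrite (rscan_cons f p) (rscan_cons f q) -(foldl_rcons_rev f q).
set f2 := foldl act f (rev (q :: s)).
rewrite -(cat1s _ (rscan f s)).
apply: (@req_ctx [::] _ [:: e; act e p; f2] [:: e; f2 \theta_p; f2]).
apply: req_gen; apply: (@PgenLink p e f2); split.
  by rewrite {2}/f2 theta_foldl revK -[X in foldl act X _]fE.
by move: eE; rewrite foldl_rcons_rev.
Qed.

Lemma last_scanl x s : last x (scanl act x s) = foldl act x s.
Proof. by elim: s x => //= p s IHs x. Qed.

Lemma rscan_cat x s t :
  rscan x (s ++ t) = rscan (foldl act x (rev t)) s ++ rscan x t.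
Proof. by rewrite /rscan rev_cat scanl_cat rev_cat. Qed.

Lemma linked_cross x y s : let e := foldl act x (rev s) \theta_y in
  let f := foldl act y s \theta_x in f = foldl act e s \theta_f.
Proof.
move=> e f; rewrite /e -theta_foldl /f; move: (foldl act y s) => w.
by rewrite -theta_conj theta2_alt theta_sym.
Qed.

Lemma psrc_pmul a b : psrc (pmul a b) = foldl act (psrc b) (rev (pseq a)).
Proof.
rewrite -[LHS]/(head (psrc b) (pseq (pmul a b))) scanl_pmul rscan_cons /=.
by rewrite -foldl_rcons_rev.
Qed.

Lemma ptgt_pmul a b : ptgt (pmul a b) = foldl act (ptgt a) (pseq b).
Proof.
rewrite -[LHS]/(last (psrc b) (pseq (pmul a b))) scanl_pmul last_cat.
by rewrite -last_scanl.
Qed.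

Lemma req_mid s u v t e f : req (e :: s ++ [:: f]) (e :: t ++ [:: f]) ->
  req (((u ++ [:: e]) ++ s) ++ [:: f] ++ v) ((u ++ [:: e]) ++ t ++ [:: f] ++ v).
Proof. by move/(req_ctx u v); rewrite -!catA /= -!catA. Qed.

Lemma pmulA_req a b c : pequiv (pmul (pmul a b) c) (pmul a (pmul b c)).
Proof.
apply: req_pequiv.
rewrite (scanl_pmul (pmul a b)) (scanl_pmul a (pmul b c)) !scanl_pmul.
rewrite psrc_pmul ptgt_pmul.
set t' := foldl act (psrc c) (rev (pseq b)).
set w := foldl act (ptgt a) (pseq b).
set e := t' \theta_(ptgt a); set f := w \theta_(psrc c).
have t'E : t' \theta_(psrc b) = t' by rewrite /t' /pseq foldl_rcons_rev theta_idem.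
have wE : w \theta_(ptgt b) = w.
  by rewrite /w /pseq lastI -cats1 foldl_cat /= /act theta_idem.
have [M1 H1] := rscan_scanl (ptgt a) (psrc c) (ispath_pseq b).
have rb : ispath (rev (pseq b)) by rewrite -pseq_prev; exact: ispath_pseq.
have [_ T2] := rscan_scanl (psrc c) (ptgt a) rb.
have M2 := scanl_rscan (ptgt a) (psrc c) (ispath_pseq b).
have hb : head (ptgt a) (pseq b) = psrc b by [].
rewrite rscan_cat scanl_cat M1 H1 M2 hb -/t' -/w -/e -/f.
have -> : rscan (e \theta_(psrc b)) (rscan (psrc b) (pseq a)) = rscan t' (pseq a).
  rewrite rscan_rscan ?ppathP // -/(ptgt a) theta2_alt.
  rewrite -rscan_theta -/(ptgt a) /e -[in LHS]t'E theta2_alt t'E.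
  exact: rscan_theta.
have -> : foldl act (ptgt a) (rscan (psrc c) (pseq b)) = f \theta_(ptgt b).
  rewrite /rscan T2 revK -/w -/f; congr (_ \theta_ _).
  by rewrite /pseq lastI rev_rcons.
have -> : scanl act (f \theta_(ptgt b)) (scanl act (ptgt b) (pseq c)) =
    scanl act w (pseq c).
  rewrite scanl_scanl ?ppathP // theta2_alt -scanl_theta /f.
  by rewrite -[in LHS]wE theta2_alt wE scanl_theta.
have [s0 ->] : exists s0, rscan t' (pseq a) = s0 ++ [:: e].
  rewrite /rscan /pseq lastI rev_rcons /= rev_cons -cats1 -/(ptgt a).
  by eexists.
have [u0 ->] : exists u0, scanl act w (pseq c) = [:: f] ++ u0 by eexists.
apply: req_mid; apply: req_linked_path; first exact: linked_cross.
have := linked_cross (ptgt a) (psrc c) (rev (pseq b)).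
by rewrite /= revK.
Qed.

Lemma scanl_id p s : path friendly p s -> scanl act p (p :: s) = p :: s.
Proof.
rewrite /= /act theta_self => ps; congr cons.
by elim: s p ps => //= q s IHs p /andP[/friendlyP[_ pq] /IHs]; rewrite /act pq => ->.
Qed.

Lemma rscan_id p s : path friendly p s -> rscan (last p s) (p :: s) = p :: s.
Proof.
move=> ps; rewrite /rscan lastI rev_rcons scanl_id ?rev_cons ?revK //.
by rewrite rev_path (eq_path (e' := friendly)) // => q r; rewrite friendly_sym.
Qed.

Lemma req_rev_path p s : path friendly p s ->
  req ((p :: s) ++ rev (p :: s)) [:: p].
Proof.
elim: s p => [|q s IHs] p; first by move=> _; exact/req_gen/PgenId.
case/andP=> pq /IHs qs; rewrite rev_cons -cats1 catA.
apply: (@req_trans _ [:: p; q; p]); last exact/req_gen/PgenBack.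
by have := req_ctx [:: p] [:: p] qs; rewrite -!catA.
Qed.

Lemma pmul_prev a : pequiv (pmul a (prevp a)) (pid (psrc a)).
Proof.
apply: req_pequiv; rewrite scanl_pmul pseq_prev psrc_prev.
rewrite rscan_id ?ppathP // -pseq_prev.
rewrite {1}/pseq psrc_prev scanl_id; last by rewrite -psrc_prev ppathP.
rewrite -psrc_prev -/(pseq (prevp a)) pseq_prev; apply: req_rev_path.
exact: ppathP.
Qed.

Lemma pmul_pid a : pequiv (pmul (pid (psrc a)) a) a.
Proof.
apply: req_pequiv; rewrite scanl_pmul.
have -> : rscan (psrc a) (pseq (pid (psrc a))) = [:: psrc a].
  by rewrite /rscan /= /act theta_self.
rewrite [ptgt _]/(psrc a) scanl_id ?ppathP //.
exact: (@req_ctx [::] (ptail a) [:: psrc a; psrc a] [:: psrc a])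
  (req_gen (PgenId _)).
Qed.

Lemma pmul_prev_mul a : pequiv (pmul (pmul a (prevp a)) a) a.
Proof.
apply: PequivTrans (pmul_pid a).
by apply: pequiv_pmul; [exact: pmul_prev | exact: PequivRefl].
Qed.

Lemma prev_pmul a b : prevp (pmul a b) = pmul (prevp b) (prevp a).
Proof.
apply: pseq_inj; rewrite pseq_prev !scanl_pmul psrc_prev ptgt_prev !pseq_prev.
by rewrite rev_cat /rscan !revK.
Qed.

Lemma prevK : involutive (prevp).
Proof. by move=> a; apply: pseq_inj; rewrite !pseq_prev revK. Qed.

Lemma pclass_repr (x : PG) : pclass (repr x) = x.
Proof. exact: reprK. Qed.

Lemma pequiv_repr a : pequiv (repr (pclass a)) a.
Proof. by apply/pclassP; rewrite pclass_repr. Qed.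

(* Product and involution do not depend on the chosen representatives, see
   [PGmulE] and [PGstarE]. *)
Definition PGmul (x y : PG) : PG := pclass (pmul (repr x) (repr y)).
Definition PGstar (x : PG) : PG := pclass (prevp (repr x)).

Lemma PGmulE a b : PGmul (pclass a) (pclass b) = pclass (pmul a b).
Proof. by apply/pclassP/pequiv_pmul; exact: pequiv_repr. Qed.

Lemma PGstarE a : PGstar (pclass a) = pclass (prevp a).
Proof. exact/pclassP/pequiv_prev/pequiv_repr. Qed.

Lemma PGmulA : associative PGmul.
Proof.
move=> x y z; rewrite -(pclass_repr x) -(pclass_repr y) -(pclass_repr z).
by rewrite !PGmulE; apply/esym/pclassP/pmulA_req.
Qed.

Lemma PGstarK : involutive PGstar.
Proof. by move=> x; rewrite -(pclass_repr x) !PGstarE prevK. Qed.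

Lemma PG_regular (x : PG) : PGmul (PGmul x (PGstar x)) x = x.
Proof.
by rewrite -(pclass_repr x) !PGstarE !PGmulE; apply/pclassP/pmul_prev_mul.
Qed.

Lemma PGstarM (x y : PG) : PGstar (PGmul x y) = PGmul (PGstar y) (PGstar x).
Proof.
rewrite -(pclass_repr x) -(pclass_repr y).
by rewrite !(PGmulE, PGstarE) prev_pmul.
Qed.

HB.instance Definition _ := isSemigroup.Build PG PGmulA.
HB.instance Definition _ :=
  Semigroup_isRegStar.Build PG PGstarK PG_regular PGstarM.

End PathCategory.

Arguments PG P : clear implicits.

Record proj (S : regStarSemigroupType) := Proj {
  proj_val : S;
  _ : (proj_val * proj_val == proj_val) && (proj_val == star proj_val)
}.

HB.instance Definition _ (S : regStarSemigroupType) :=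
  [isSub of proj S for @proj_val S].
HB.instance Definition _ (S : regStarSemigroupType) :=
  [Choice of proj S by <:].

Section Projections.
Variable S : regStarSemigroupType.
Implicit Types p q x : proj S.

Lemma projM p : val p * val p = val p.
Proof. by case: p => p /= /andP[/eqP]. Qed.

Lemma proj_star p : star (val p) = val p.
Proof. by case: p => p /= /andP[_ /eqP <-]. Qed.

Lemma mul_projK (x : S) p : x * val p * val p = x * val p.
Proof. by rewrite -mulgA projM. Qed.

Lemma proj_mul_idem p q : val p * val q * val p * val q = val p * val q.
Proof.
have := mul_star_mul (val p * val q); rewrite starM !proj_star !mulgA.
by rewrite !mul_projK.
Qed.

Lemma mul_proj_mulK (x : S) p q :
  x * val p * val q * val p * val q = x * val p * val q.
Proof.
have := congr1 (mul x) (proj_mul_idem p q).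
by rewrite !mulgA.
Qed.

Lemma proj_theta_subproof p q :
  (val p * val q * val p * (val p * val q * val p) == val p * val q * val p) &&
  (val p * val q * val p == star (val p * val q * val p)).
Proof.
by rewrite !starM !proj_star !mulgA eqxx andbT mul_projK proj_mul_idem.
Qed.

(* q \theta_p = pqp *)
Definition proj_theta p q : proj S := Proj (proj_theta_subproof p q).

Lemma proj_theta_self p : proj_theta p p = p.
Proof. by apply: val_inj; rewrite /= !projM. Qed.

Lemma proj_theta_idem p x : proj_theta p (proj_theta p x) = proj_theta p x.
Proof.
by apply: val_inj; rewrite /= !mulgA projM mul_projK.
Qed.

Lemma proj_theta_sym p q : proj_theta p (proj_theta q p) = proj_theta p q.
Proof.
by apply: val_inj; rewrite /= !mulgA proj_mul_idem.
Qed.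

Lemma proj_theta_conj p q x :
  proj_theta p (proj_theta q (proj_theta p x)) =
  proj_theta (proj_theta p q) x.
Proof. by apply: val_inj; rewrite /= !mulgA. Qed.

Lemma proj_theta_alt p q x :
  proj_theta q (proj_theta p (proj_theta q (proj_theta p x))) =
  proj_theta q (proj_theta p x).
Proof.
by apply: val_inj; rewrite /= !mulgA proj_mul_idem mul_proj_mulK.
Qed.

HB.instance Definition _ := isProjAlgebra.Build (proj S)
  proj_theta_self proj_theta_idem proj_theta_sym proj_theta_conj
  proj_theta_alt.

End Projections.

Record idem (T : semigroupType) := Idem {
  idem_val : T;
  _ : idem_val * idem_val == idem_val
}.

HB.instance Definition _ (T : semigroupType) :=
  [isSub of idem T for @idem_val T].
HB.instance Definition _ (T : semigroupType) := [Choice of idem T by <:].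

Section Boset.
Variable T : semigroupType.
Implicit Types e f : idem T.

Lemma idemM e : val e * val e = val e.
Proof. by case: e => e /= /eqP. Qed.

(* {e, f} meets {ef, fe}. *)
Definition basic_pair e f : bool :=
  (val e \in [:: val e * val f; val f * val e]) ||
  (val f \in [:: val e * val f; val f * val e]).

Lemma bmul_subproof e f :
  basic_pair e f -> val e * val f * (val e * val f) == val e * val f.
Proof.
rewrite /basic_pair !inE; case/orP=> /orP[] /eqP E.
- by rewrite -E idemM.
- by rewrite -mulgA (mulgA (val f)) -E mulgA idemM.
- by rewrite -E idemM.
- by rewrite -mulgA (mulgA (val f)) -E idemM.
Qed.

Definition bmul e f (h : basic_pair e f) : idem T := Idem (bmul_subproof h).

End Boset.

Section StarBoset.
Variable T : regStarSemigroupType.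

Lemma istar_subproof (e : idem T) : star (val e) * star (val e) == star (val e).
Proof. by rewrite -starM idemM. Qed.

Definition istar (e : idem T) : idem T := Idem (istar_subproof e).

End StarBoset.

Definition star_boset_iso (T T' : regStarSemigroupType)
    (phi : idem T -> idem T') : Prop :=
  [/\ bijective phi,
      forall e f, basic_pair e f <-> basic_pair (phi e) (phi f),
      forall e f (h : basic_pair e f) (h' : basic_pair (phi e) (phi f)),
        phi (bmul h) = bmul h'
    & forall e, phi (istar e) = istar (phi e)].

Section IdemPG.
Variable P : projAlgebraType.

Lemma pclass_pair_subproof (p q : P) (h : friendly p q) :
  pclass (ppair h) * pclass (ppair h) == pclass (ppair h).
Proof.
apply/eqP; rewrite [LHS]PGmulE; apply/pclassP/req_pequiv.
have /friendlyP[qp pq] := h.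
rewrite scanl_pmul -[ptgt _]/q -[psrc _]/p -[pseq _]/[:: p; q].
rewrite /rscan /= /act pq qp pq.
apply: (@req_ctx _ [::] [:: q] [:: p; q; p] [:: p]).
exact/req_gen/PgenBack.
Qed.

Definition pclass_pair (p q : P) (h : friendly p q) : idem (PG P) :=
  Idem (pclass_pair_subproof h).

Lemma PG_proj_mul (p q : P) : pclass (pid p) * pclass (pid q) =
  pclass (ppair (friendly_cross q p)).
Proof.
rewrite [LHS]PGmulE; apply/pclassP/req_pequiv; rewrite scanl_pmul.
exact: req_refl.
Qed.

Lemma PG_mul_star (a : ppath P) :
  pclass a * star (pclass a) = pclass (pid (psrc a)).
Proof.
by rewrite [star _]PGstarE [LHS]PGmulE; apply/pclassP/pmul_prev.
Qed.

Lemma idemPG_pair (e : idem (PG P)) :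
  exists p q (h : friendly p q), e = pclass_pair h.
Proof.
have [a def_e] : exists a, pclass a = val e by exists (repr (val e)); exact: pclass_repr.
pose p := psrc a; pose q := ptgt a.
exists (q \theta_p), (p \theta_q), (friendly_cross q p); apply: val_inj => /=.
rewrite -PG_proj_mul -(PG_mul_star a) -[q]/(psrc (prevp a)) -PG_mul_star.
rewrite -[pclass (prevp a)]PGstarE -/(star (pclass a)) def_e starK.
rewrite mulgA -(mulgA (val e)) -starM idemM mul_star_mul.
by [].
Qed.

End IdemPG.

(* Main.v *)
Require Import Defs.
From HB Require Import structures.
From mathcomp Require Import all_boot.

(** The map on idempotents is the restriction of a morphism of regular
    *-semigroups [PG_eval] from [PG (proj S)] to [S], which sends the class of
    a path (p_1, ..., p_k) to the product p_1 ... p_k ([peval]).  It is well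
    defined because the two sides of each generating pair have equal products
    in [S] ([mulseq_pgen]).  It is multiplicative ([peval_pmul]) because every
    product rq of projections satisfies r(qrq) = rq, so that the entries of a
    restricted path can be replaced, inside a product, by those of the path
    itself: the projections p_1', ..., p_k', q_1', ..., q_l' multiply to
    p_1 ... p_k (q_1 p_k) q_1 ... q_l, where p_k q_1 p_k q_1 = p_k q_1.

    The projections of [PG (proj S)] are the classes of the one-term paths, so
    this morphism is bijective from projections to projections.  The rest is a
    general fact ([proj_bijective_boset_iso]) on a *-morphism F : T -> S that
    is bijective on projections.  An idempotent e is the product of the
    projections ee* and e*e, and a product of two projections is idempotent;
    hence F is bijective on idempotents.  For idempotents e and f, ef = e says
    that e*e lies below f*f, that is (f*f)(e*e)(f*f) = e*e
    ([idem_absorbP]).  This is an equality between projections, so it holds in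
    T as soon as it holds in S; with the involution this covers all the
    conditions that define basic pairs. *)

Set Implicit Arguments.
Unset Strict Implicit.
Unset Printing Implicit Defensive.

Local Open Scope group_scope.

(** * Idempotents and projections of a regular *-semigroup *)

Section RegStar.
Variable S : regStarSemigroupType.
Implicit Types (x y : S) (p q : proj S) (e f : idem S).

Lemma range_subproof x :
  (x * star x * (x * star x) == x * star x) && (x * star x == star (x * star x)).
Proof. by rewrite starM starK mulgA mul_star_mul !eqxx. Qed.

Definition range x : proj S := Proj (range_subproof x).

Lemma idem_range_mul e : val (range (val e)) * val (range (star (val e))) = val e.
Proof.
by rewrite /= starK mulgA -(mulgA (val e)) -starM idemM mul_star_mul.
Qed.

Lemma proj_mul_idem_subproof p q :
  val p * val q * (val p * val q) == val p * val q.
Proof. by rewrite !mulgA proj_mul_idem. Qed.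

Definition proj_idem p q : idem S := Idem (proj_mul_idem_subproof p q).

Lemma proj_leP p q : val q * val p = val q <-> q \theta_p = q.
Proof.
split=> [qp|/(congr1 val)/= pqp]; last by rewrite -{1}pqp mul_projK pqp.
apply: val_inj; rewrite /= -mulgA qp.
by rewrite -[in LHS](proj_star p) -[in LHS](proj_star q) -starM qp proj_star.
Qed.

Lemma range_starE x : val (range (star x)) = star x * x.
Proof. by rewrite /= starK. Qed.

Lemma mul_range_star x : x * val (range (star x)) = x.
Proof. by rewrite range_starE mulgA mul_star_mul. Qed.

(** Right absorption compares L-classes, hence only sees the projections e*e
    and f*f. *)
Lemma idem_absorbP e f : val e * val f = val e <->
  range (star (val e)) \theta_(range (star (val f))) = range (star (val e)).
Proof.
split=> [ef|/proj_leP qp]; first apply/proj_leP.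
  have ep : val e * val (range (star (val f))) = val e.
    by rewrite -[in LHS]ef -mulgA mul_range_star ef.
  by rewrite (range_starE (val e)) -mulgA ep.
have ep : val e * val (range (star (val f))) = val e.
  by rewrite -{1}(mul_range_star (val e)) -mulgA qp mul_range_star.
by rewrite -[in LHS]ep -mulgA range_starE -(mulgA (star _)) idemM -range_starE.
Qed.

End RegStar.

(** * Star morphisms that are bijective on projections *)

Section ProjBijective.
Variables (T S : regStarSemigroupType) (F : T -> S).
Hypothesis FM : forall x y, F (x * y) = F x * F y.
Hypothesis Fstar : forall x, F (star x) = star (F x).
Hypothesis Finj : forall p q : proj T, F (val p) = F (val q) -> p = q.
Hypothesis Fsurj : forall p : proj S, exists q : proj T, F (val q) = val p.

Lemma idem_map_subproof (e : idem T) : F (val e) * F (val e) == F (val e).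
Proof. by rewrite -FM idemM. Qed.

Definition idem_map (e : idem T) : idem S := Idem (idem_map_subproof e).

Lemma map_range x : F (val (range x)) = val (range (F x)).
Proof. by rewrite /= FM Fstar. Qed.

Lemma idem_map_inj : injective idem_map.
Proof.
move=> e f /(congr1 val)/= ef; apply: val_inj.
rewrite -(idem_range_mul e) -(idem_range_mul f).
have -> : range (val e) = range (val f) by apply: Finj; rewrite !map_range ef.
suff -> : range (star (val e)) = range (star (val f)) by [].
by apply: Finj; rewrite !map_range !Fstar ef.
Qed.

Lemma idem_map_surj e : exists e', idem_map e' == e.
Proof.
have [p pE] := Fsurj (range (val e)).
have [q qE] := Fsurj (range (star (val e))).
exists (proj_idem p q); apply/eqP/val_inj.
by rewrite -(idem_range_mul e) /= FM pE qE.
Qed.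

Lemma idem_map_bij : bijective idem_map.
Proof.
exists (fun e => xchoose (idem_map_surj e)).
  by move=> e; apply: idem_map_inj; apply/eqP/(xchooseP (idem_map_surj _)).
by move=> e; apply/eqP/(xchooseP (idem_map_surj e)).
Qed.

Lemma idem_map_star e : idem_map (istar e) = istar (idem_map e).
Proof. by apply: val_inj; rewrite /= Fstar. Qed.

(** By [idem_absorbP] absorption is an equality between projections, which F
    reflects by injectivity. *)
Lemma absorb_map (e f : idem T) :
  (F (val e) == F (val e) * F (val f)) = (val e == val e * val f).
Proof.
apply/eqP/eqP=> [/esym|ef]; last by rewrite -FM -ef.
move/(idem_absorbP (idem_map e) (idem_map f)) => /(congr1 val) ef.
apply/esym/idem_absorbP/Finj; rewrite map_range Fstar.
by rewrite -[RHS]ef /= !(FM, Fstar).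
Qed.

(** This follows from [absorb_map], as the involution exchanges left and right
    absorption. *)
Lemma absorb_map_left (e f : idem T) :
  (F (val e) == F (val f) * F (val e)) = (val e == val f * val e).
Proof.
rewrite -(inj_eq (can_inj (@starK S))) -[RHS](inj_eq (can_inj (@starK T))).
by rewrite !starM -!Fstar (absorb_map (istar e) (istar f)).
Qed.

Lemma proj_bijective_boset_iso : star_boset_iso idem_map.
Proof.
split.
- exact: idem_map_bij.
- by move=> e f; rewrite /basic_pair !inE /= !absorb_map !absorb_map_left.
- by move=> e f h h'; apply: val_inj; rewrite /= FM.
- exact: idem_map_star.
Qed.

End ProjBijective.

(** * Evaluation of paths *)

Section Evaluation.
Variable S : regStarSemigroupType.
Implicit Types (x y : S) (p q r : proj S) (s t : seq (proj S)).
Implicit Types (a b : ppath (proj S)).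

Definition mulseq x s : S := foldl (fun y q => y * val q) x s.

Lemma mulseq_cons x q s : mulseq x (q :: s) = mulseq (x * val q) s.
Proof. by []. Qed.

Lemma mulseq_cat x s t : mulseq x (s ++ t) = mulseq (mulseq x s) t.
Proof. exact: foldl_cat. Qed.

Lemma mulseq_rcons x s q : mulseq x (rcons s q) = mulseq x s * val q.
Proof. by rewrite -cats1 mulseq_cat. Qed.

Lemma mulseqM x y s : mulseq (x * y) s = x * mulseq y s.
Proof. by elim: s y => //= q s IHs y; rewrite -mulgA IHs. Qed.

Lemma mulseq_pgen x s t : pgen s t -> mulseq x s = mulseq x t.
Proof.
case=> [p|p q|p e f _]; rewrite /mulseq /=; first exact: mul_projK.
  case/friendlyP=> /(congr1 val) /= qp _.
  by rewrite -!mulgA (mulgA (val p)) qp.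
(* As ep and pf are idempotent, both e(pep)f and e(pfp)f equal epf. *)
by rewrite !mulgA !mul_proj_mulK.
Qed.

Lemma mulseq_req x s t : req s t -> mulseq x s = mulseq x t.
Proof.
move=> st; elim/req_ind: {s t} st x => [s|s t IH|s t u _ IH1 IH2|u v A B g] x //.
- by rewrite IH1 IH2.
- by rewrite !mulseq_cat (mulseq_pgen _ g).
Qed.

(** Two consecutive entries of the scan are r and qrq, and r(qrq) = rq: past
    the initial r, the scan multiplies as the path itself does. *)
Lemma mulseq_scanl x r s :
  mulseq (x * val r) (scanl act r s) = mulseq (x * val r) s.
Proof.
elim: s x r => // q s IHs x r.
rewrite [RHS]mulseq_cons; apply: (etrans (IHs (x * val r) (act r q))).
by rewrite /= !mulgA mul_proj_mulK.
Qed.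

Lemma rscan_rcons r s q :
  rscan r (rcons s q) = rcons (rscan (r \theta_q) s) (r \theta_q).
Proof. by rewrite /rscan rev_rcons /= rev_cons. Qed.

(** The mirror image of [mulseq_scanl], with the scan running leftwards from a
    final factor r. *)
Lemma mulseq_rscan x r s :
  mulseq x (rscan r s) * val r = mulseq x s * val r.
Proof.
elim/last_ind: s r => // s q IHs r.
by rewrite rscan_rcons !mulseq_rcons IHs /= !mulgA mul_proj_mulK.
Qed.

Lemma mulseq_rscan_rcons x r s q :
  mulseq x (rscan r (rcons s q)) = mulseq x (rcons s q) * val r * val q.
Proof. by rewrite rscan_rcons !mulseq_rcons mulseq_rscan /= !mulgA. Qed.

(** The factor x on the left makes up for the missing identity element: a
    reversed product needs an initial value. *)
Lemma star_mulseq x y s : x * star (mulseq y s) = mulseq x (rev s) * star y.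
Proof.
elim/last_ind: s x => // s q IHs x.
by rewrite mulseq_rcons rev_rcons starM proj_star mulgA IHs.
Qed.

Definition peval a : S := mulseq (val (psrc a)) (ptail a).

(** [peval_pmul] uses this with x = p_1: the first entry of the product of two
    paths lies below p_1, which then serves as initial value for both. *)
Lemma peval_mulseq x a : x * val (psrc a) = val (psrc a) ->
  mulseq x (pseq a) = peval a.
Proof. by rewrite /mulseq /= => ->. Qed.

Lemma mulseq_psrc a : mulseq (val (psrc a)) (pseq a) = peval a.
Proof. exact/peval_mulseq/projM. Qed.

Lemma peval_ptgt a : peval a * val (ptgt a) = peval a.
Proof. by rewrite -mulseq_psrc /pseq lastI mulseq_rcons mul_projK. Qed.

Lemma peval_pequiv a b : pequiv a b -> peval a = peval b.
Proof.
move/pequiv_req=> ab; rewrite -!mulseq_psrc (mulseq_req _ ab).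
by have [/(_ (psrc a)) /= -> _] := req_invar ab.
Qed.

Lemma peval_pmul a b : peval (pmul a b) = peval a * peval b.
Proof.
rewrite -(@peval_mulseq (val (psrc a))); last first.
  rewrite psrc_pmul /pseq foldl_rcons_rev /=.
  by rewrite !mulgA projM.
(* The left half multiplies to p_1 ... p_k q_1 p_k.  Its last factor p_k is
   where the scan of the right half starts. *)
rewrite scanl_pmul mulseq_cat {1}/pseq lastI mulseq_rscan_rcons -lastI.
rewrite -/(pseq a) -/(ptgt a) mulseq_psrc mulseq_scanl.
(* Write p_1 ... p_k as (p_1 ... p_k) p_k to cancel with p_k q_1 p_k q_1. *)
rewrite [LHS]/(mulseq (_ * val (psrc b)) (ptail b)) /peval -mulseqM -/(peval a).
by rewrite -(peval_ptgt a) mul_proj_mulK.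
Qed.

Lemma peval_prev a : peval (prevp a) = star (peval a).
Proof.
rewrite -[in RHS]peval_ptgt starM proj_star -mulseq_psrc psrc_prev pseq_prev.
rewrite -(mulseq_psrc a) star_mulseq proj_star.
by rewrite /pseq rev_cons mulseq_rcons mul_projK.
Qed.

Definition PG_eval (x : PG (proj S)) : S := peval (repr x).

Lemma PG_evalE a : PG_eval (pclass a) = peval a.
Proof. exact/peval_pequiv/pequiv_repr. Qed.

Lemma PG_evalM (x y : PG (proj S)) : PG_eval (x * y) = PG_eval x * PG_eval y.
Proof. by rewrite [x * y]/(PGmul x y) PG_evalE peval_pmul. Qed.

Lemma PG_eval_star (x : PG (proj S)) : PG_eval (star x) = star (PG_eval x).
Proof. by rewrite [star x]/(PGstar x) PG_evalE peval_prev. Qed.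

(** A projection p equals pp*, the class of the one-term path at the source of
    any representative. *)
Lemma PG_projE (p : proj (PG (proj S))) : exists q, val p = pclass (pid q).
Proof.
exists (psrc (repr (val p))).
by rewrite -PG_mul_star pclass_repr proj_star projM.
Qed.

Lemma PG_eval_proj_inj (p q : proj (PG (proj S))) :
  PG_eval (val p) = PG_eval (val q) -> p = q.
Proof.
have [p' pE] := PG_projE p; have [q' qE] := PG_projE q.
by rewrite pE qE !PG_evalE => /(@val_inj _ _ _ p' q') pq;
  apply: val_inj; rewrite pE qE pq.
Qed.

Lemma PG_eval_proj_surj p : exists q : proj (PG (proj S)), PG_eval (val q) = val p.
Proof.
exists (range (pclass (pid p))).
by rewrite [val _]PG_mul_star PG_evalE.
Qed.

End Evaluation.

Theorem proposition6p10 (S : regStarSemigroupType) :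
  exists phi : idem (PG (proj S)) -> idem S,
    (forall (p q : proj S) (h : friendly p q),
        val (phi (pclass_pair h)) = val p * val q) /\
    star_boset_iso phi.
Proof.
exists (idem_map (@PG_evalM S)); split=> [p q h|]; first exact: PG_evalE.
apply: proj_bijective_boset_iso.
- exact: PG_eval_star.
- exact: PG_eval_proj_inj.
- exact: PG_eval_proj_surj.
Qed.
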